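(* Let $I$ and $K$ be non-trivial ideals on a non-empty set $S$ and let $X$ be a first countable topological space. Suppose that $K$ is a $P$-ideal and that $I$ has the additive property with respect to $K$ (i.e. condition $\mathrm{AP}(I,K)$ holds). Then for every function $f:S\to X$ and every $x\in X$, if $f$ is $I$-convergent to $x$, then $f$ is $I^{K^*}$-convergent to $x$.
   Context: An ideal on a non-empty set $S$ is a family $I\subset 2^S$ closed under finite unions and under taking subsets. It is non-trivial if $S\notin I$ and $I\neq\{\emptyset\}$. The associated filter is $F(I)=\{A\subset S: S\setminus A\in I\}$. $\mathrm{Fin}(S)$ is the ideal of all finite subsets of $S$. For an ideal $J$ on $S$, a function $g:S\to X$ is $J$-convergent to $x$ if $\{s\in S: g(s)\notin U\}\in J$ for every neighborhood $U$ of $x$. A function $f:S\to X$ is $I^{K^*}$-convergent to $x$ if there are $M\in F(I)$ and $M_1\in F(K)$ such that the function $g$ given by $g(s)=f(s)$ for $s\in M\cap M_1$, $g(s)=x$ for $s\notin M\cap M_1$, is $\mathrm{Fin}(S)$-convergent to $x$. Condition $\mathrm{AP}(I,K)$, for ideals $I,K$ on $S$, is any one of the following equivalent conditions: (i) for every sequence $(A_n)_{n\in\mathbb{N}}$ of sets from $I$ there is $A\in I$ with $A_n\setminus A\in K$ for all $n$; (ii) for every sequence $(F_n)_{n\in\mathbb{N}}$ of sets from $F(I)$ there is $F\in F(I)$ with $F\setminus F_n\in K$ for all $n$; (iii) for every sequence $(A_n)_{n\in\mathbb{N}}$ of pairwise disjoint sets from $I$ there is a sequence $(B_n)_{n\in\mathbb{N}}$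 of sets from $I$ with $A_n\bigtriangleup B_n\in K$ for each $n$ and $\bigcup_{n\in\mathbb{N}}B_n\in I$. An ideal $K$ on $S$ is a $P$-ideal if condition $\mathrm{AP}(K,\mathrm{Fin}(S))$ holds. *)

(* Defs.v *)
From mathcomp Require Import all_boot.
From mathcomp Require Import all_classical topology.

Set Implicit Arguments.
Unset Strict Implicit.
Unset Printing Implicit Defensive.

Local Open Scope classical_set_scope.

(* [I set0] is closure under the union of the empty family; it makes every
   ideal inhabited. *)
Definition ideal (S : Type) (I : set_system S) : Prop :=
  [/\ I set0, setU_closed I & forall A B : set S, A `<=` B -> I B -> I A].

Definition nontrivial_ideal (S : Type) (I : set_system S) : Prop :=
  [/\ ideal I, ~ I [set: S] & I <> [set set0]].

Definition assoc_filter (S : Type) (I : set_system S) : set_system S :=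
  [set A | I (~` A)].

Definition Fin (S : Type) : set_system S := [set A | finite_set A].

Definition ideal_cvg (S : Type) (X : topologicalType) (J : set_system S)
    (g : S -> X) (x : X) : Prop :=
  forall U : set X, nbhs x U -> J [set s | ~ U (g s)].

(* [patch (cst x) A f] equals [f] on [A] and [x] outside [A]. *)
Definition IKstar_cvg (S : Type) (X : topologicalType) (I K : set_system S)
    (f : S -> X) (x : X) : Prop :=
  exists M M1 : set S, [/\ assoc_filter I M, assoc_filter K M1 &
    ideal_cvg (@Fin S) (patch (cst x) (M `&` M1) f) x].

Definition AP (S : Type) (I K : set_system S) : Prop :=
  forall A_ : nat -> set S, (forall n, I (A_ n)) ->
    exists2 A : set S, I A & forall n, K (A_ n `\` A).

Definition P_ideal (S : Type) (K : set_system S) : Prop := AP K (@Fin S).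

Definition first_countable (X : topologicalType) : Prop :=
  forall x : X, exists B : set_system X,
    [/\ countable B, forall V : set X, B V -> nbhs x V &
        forall U : set X, nbhs x U -> exists2 V : set X, B V & V `<=` U].

(* Main.v *)
Require Import Defs.
From mathcomp Require Import all_boot.
From mathcomp Require Import all_classical topology.

Local Open Scope classical_set_scope.

(** Take a countable neighborhood base [V_0, V_1, ...] at [x]. The sets
    [A_n = {s | f s \notin V_n}] belong to [I], so [AP I K] yields one [A] in
    [I] that contains every [A_n] up to an error in [K]. These errors form a
    sequence of sets from the P-ideal [K], hence one [C] in [K] contains all of
    them up to finite sets. Outside [A `|` C] only finitely many points of [S]
    are mapped out of [V_n], for each [n], and this is the required convergence
    with [M = ~` A] and [M1 = ~` C]. Chaining the two additive properties is
    [AP_comp]; [ideal_cvg_countable_base] provides the sequence [A_n]. *)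

(** The errors left by the first property are the sequence to which the second
    one applies. *)
Lemma AP_comp (S : Type) (I K J : set_system S) : AP I K -> AP K J ->
  forall A_ : nat -> set S, (forall n, I (A_ n)) ->
  exists A C : set S, [/\ I A, K C & forall n, J ((A_ n `\` A) `\` C)].
Proof.
move=> API APK A_ IA_.
have [A IA KA] := API A_ IA_.
by have [C KC JC] := APK _ KA; exists A, C; split.
Qed.

Lemma ideal_cvg_countable_base (S : Type) (I : set_system S)
    (X : topologicalType) (f : S -> X) (x : X) :
  ideal I -> first_countable X -> ideal_cvg I f x ->
  exists2 A_ : nat -> set S, (forall n, I (A_ n)) &
    forall U, nbhs x U -> exists n, [set s | ~ U (f s)] `<=` A_ n.
Proof.
move=> [I0 _ _] Xfc fx; have [B [cB Bx xB]] := Xfc x.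
have [e e_inj] := countable_injP _ cB.
(* [e] need not be onto: an index that codes no member of the base gives the
   empty set, which lies in [I]. *)
exists (fun n => [set s | exists2 V, B V /\ e V = n & ~ V (f s)]).
- move=> n; have [[V [BV eV]]|noV] := pselect (exists V, B V /\ e V = n).
  + rewrite (_ : mkset _ = [set s | ~ V (f s)]); first exact/fx/Bx.
    apply/seteqP; split=> [s [W [BW eW] nWs]|s nVs]; last by exists V.
    by rewrite /= (e_inj V W) ?inE// eV eW.
  + rewrite (_ : mkset _ = set0)//; apply/seteqP; split=> // s [V BV _].
    by apply: noV; exists V.
- move=> U /xB[V BV VU]; exists (e V) => s nUs.
  by exists V => // /VU.
Qed.

Theorem theorem4p4 (S : Type) (S_nonempty : [set: S] !=set0)
    (I K : set_system S) (X : topologicalType)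
    (I_ideal : nontrivial_ideal I) (K_ideal : nontrivial_ideal K)
    (X_first_countable : first_countable X)
    (K_P_ideal : P_ideal K) (I_AP_K : AP I K) :
  forall (f : S -> X) (x : X), ideal_cvg I f x -> IKstar_cvg I K f x.
Proof.
move=> f x fx; have [idI _ _] := I_ideal.
have [A_ IA_ A_U] := ideal_cvg_countable_base _ _ _ _ _ idI X_first_countable fx.
have [A [C [IA KC finAC]]] := AP_comp _ _ _ _ I_AP_K K_P_ideal _ IA_.
exists (~` A), (~` C); rewrite /assoc_filter /= !setCK; split=> // U xU.
have [n Un] := A_U U xU.
apply: sub_finite_set (finAC n) => s /=.
rewrite /patch; case: ifPn => [|_ nUx]; last by case: nUx; exact: nbhs_singleton.
by rewrite inE => -[nAs nCs] nUs; split=> //; split=> //; exact: Un.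
Qed.
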